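(* Let $\mathbb{H},\mathbb{H}'$ be complete Heyting algebras and let $f:\mathbb{H}\to\mathbb{H}'$ be a function preserving arbitrary suprema and finite infima. Let $\tilde f\subseteq V^{(\mathbb{H})}\times V^{(\mathbb{H}')}$ be the relation defined in the context. Let $\varphi(v_1,\dots,v_n)$ be a positive formula with bounded quantifiers in the language of set theory, i.e. a formula built from atomic formulas $v\in w$, $v=w$ using only $\wedge$, $\vee$ and bounded quantifiers $\exists u\in v$, $\forall u\in v$. Then for all $\langle a_1,a_1'\rangle,\dots,\langle a_n,a_n'\rangle\in\tilde f$, $$f\big([\![\varphi(a_1,\dots,a_n)]\!]\big)\leq[\![\varphi(a_1',\dots,a_n')]\!]',$$ where $\leq$ is the order of $\mathbb{H}'$.
   Context: For a complete Heyting algebra $\mathbb{H}$, define by recursion on ordinals $V^{(\mathbb{H})}_\alpha=\{x : x \text{ is a function from a set } X \text{ to } \mathbb{H},\ X\subseteq V^{(\mathbb{H})}_\beta \text{ for some } \beta<\alpha\}$, and $V^{(\mathbb{H})}=\bigcup_{\alpha} V^{(\mathbb{H})}_\alpha$. The rank of $x\in V^{(\mathbb{H})}$ is $\varrho(x)=\min\{\alpha : x\in V^{(\mathbb{H})}_\alpha\}$; for $u\in\mathrm{dom}(x)$ one has $\varrho(u)<\varrho(x)$. For $x,y\in V^{(\mathbb{H})}$ define, by simultaneous well-founded recursion, $$[\![x\in y]\!]=\bigvee_{u\in\mathrm{dom}(y)} y(u)\wedge[\![x=u]\!],\qquad [\![x=y]\!]=\bigwedge_{v\in\mathrm{dom}(x)}\big(x(v)\to[\![v\in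 y]\!]\big)\wedge\bigwedge_{u\in\mathrm{dom}(y)}\big(y(u)\to[\![u\in x]\!]\big).$$ The valuation extends to formulas with parameters in $V^{(\mathbb{H})}$ by $[\![\varphi*\psi]\!]=[\![\varphi]\!]*[\![\psi]\!]$ for $*\in\{\wedge,\vee,\to\}$, $[\![\forall u\,\varphi(u)]\!]=\bigwedge_{u\in V^{(\mathbb{H})}}[\![\varphi(u)]\!]$ and $[\![\exists u\,\varphi(u)]\!]=\bigvee_{u\in V^{(\mathbb{H})}}[\![\varphi(u)]\!]$. The bounded quantifiers $\exists u\in x\ \varphi(u)$ and $\forall u\in x\ \varphi(u)$ abbreviate $\exists u(u\in x\wedge\varphi(u))$ and $\forall u(u\in x\to\varphi(u))$; it is known that $[\![\exists u\in x\ \varphi(u)]\!]=\bigvee_{u\in\mathrm{dom}(x)}x(u)\wedge[\![\varphi(u)]\!]$ and $[\![\forall u\in x\ \varphi(u)]\!]=\bigwedge_{u\in\mathrm{dom}(x)}\big(x(u)\to[\![\varphi(u)]\!]\big)$. The class $V^{(\mathbb{H}')}$ and its valuation, written $[\![\cdot]\!]'$, are defined in the same way from $\mathbb{H}'$. Definition of $\tilde f$ (by recursion on the rank of $x$): for an ordinal $\alpha$, $x\in V^{(\mathbb{H})}_\alpha$ and $y'\in V^{(\mathbb{H}')}$, $\langle x,y'\rangle\in\tilde f_\alpha$ if and only if there are $x'\in V^{(\mathbb{H}')}$ with $[\![x'=y']\!]'=1$ and a surjection $\varepsilon:\mathrm{dom}(x)\to\mathrm{dom}(x')$ such that $\langle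 u,\varepsilon(u)\rangle\in\tilde f_{\varrho(x)}$ for all $u\in\mathrm{dom}(x)$, and $x'\circ\varepsilon=f\circ x$. Put $\tilde f=\bigcup_\alpha\tilde f_\alpha$, the union over all ordinals. *)

(* Defs.v *)
From HB Require Import structures.
From mathcomp Require Import all_boot all_order.
From mathcomp Require Import mathcomp_extra boolp classical_sets.

Set Implicit Arguments.
Unset Strict Implicit.
Unset Printing Implicit Defensive.

Import Order.TTheory.
Local Open Scope classical_set_scope.
Local Open Scope order_scope.

(** * Complete Heyting algebras *)

HB.mixin Record isCompleteHeyting (d : Order.disp_t) T & Order.TBLattice d T := {
  bigjoin : set T -> T;
  himp : T -> T -> T;
  bigjoin_supremum : forall S : set T, supremums S (bigjoin S);
  himpP : forall x y z : T, (z <= himp x y) = (Order.meet z x <= y)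
}.

#[short(type="completeHeytingType")]
HB.structure Definition CompleteHeyting (d : Order.disp_t) :=
  {T of Order.TBLattice d T & isCompleteHeyting d T}.

Section FamilyBounds.
Context {d : Order.disp_t} {H : completeHeytingType d}.

Definition bigmeet (S : set H) : H := bigjoin (lbound S).

Definition hsup {I : Type} (F : I -> H) : H := bigjoin (range F).
Definition hinf {I : Type} (F : I -> H) : H := bigmeet (range F).

End FamilyBounds.

Definition preserves_suprema {d d' : Order.disp_t}
    {H : completeHeytingType d} {H' : completeHeytingType d'} (f : H -> H') :=
  forall S : set H, f (bigjoin S) = bigjoin (f @` S)%classic.

(* The empty infimum is the top element. *)
Definition preserves_finite_infima {d d' : Order.disp_t}
    {H : completeHeytingType d} {H' : completeHeytingType d'} (f : H -> H') :=
  f \top = \top /\ forall x y : H, f (Order.meet x y) = Order.meet (f x) (f y).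

(** * Ordinals *)

(* [Ord f] is the least ordinal strictly above every [f i]; distinct trees may
   represent the same ordinal, so ordinals are compared with [ord_le] only. *)
Inductive ord : Type := Ord (A : Type) (f : A -> ord).

Fixpoint ord_le (a b : ord) : Prop :=
  match a, b with
  | Ord A f, Ord B g => forall i : A, exists j : B, ord_le (f i) (g j)
  end.

Definition ord_lt (a b : ord) : Prop :=
  match b with Ord B g => exists j : B, ord_le a (g j) end.

Definition ord_succ (a : ord) : ord := Ord (fun _ : unit => a).

Definition ord_dom (a : ord) : Type := match a with Ord A _ => A end.
Definition ord_el (a : ord) : ord_dom a -> ord :=
  match a with Ord _ f => f end.

Definition ord_sup (I : Type) (f : I -> ord) : ord :=
  Ord (fun p : {i : I & ord_dom (f i)} => ord_el (projT2 p)).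

Lemma ord_le_refl a : ord_le a a.
Proof. by elim: a => I f IH /= i; exists i; apply: IH. Qed.

Lemma ord_le_trans a b c : ord_le a b -> ord_le b c -> ord_le a c.
Proof.
elim: a b c => I f IH [J g] [K h] /= fg gh i.
by have [j fgj] := fg i; have [k ghk] := gh j; exists k; apply: IH ghk.
Qed.

Lemma ord_lt_le_trans a b c : ord_lt a b -> ord_le b c -> ord_lt a c.
Proof.
case: b c => [J g] [K h] /= [j agj] gh.
by have [k ghk] := gh j; exists k; apply: ord_le_trans ghk.
Qed.

Lemma ord_le_sup (I : Type) (f : I -> ord) i : ord_le (f i) (ord_sup f).
Proof.
rewrite /ord_sup; case E: (f i) => [J g] j /=.
have [j' ->] : exists j' : ord_dom (f i), g j = ord_el j'.
  by rewrite E; exists j.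
by exists (existT _ i j'); apply: ord_le_refl.
Qed.

Lemma ord_sup_le (I : Type) (f : I -> ord) b :
  (forall i, ord_le (f i) b) -> ord_le (ord_sup f) b.
Proof.
case: b => [K h] fb [i j] /=.
by move: (fb i) j; case: (f i) => J g /= gh j; exact: gh.
Qed.

(** * The universe of H-valued sets *)

(* [Name e v] presents the set of pairs (e i, v i), for i in X. *)
Inductive name (H : Type) : Type :=
  Name (X : Type) (el : X -> name H) (v : X -> H).

(* Two presentations have the same pairs, i.e. give the same set in the sense
   of the ambient set theory (this is not the H-valued equality). *)
Fixpoint same {H : Type} (x y : name H) : Prop :=
  match x, y with
  | Name X e v, Name Y e' v' =>
      (forall i : X, exists j : Y, same (e i) (e' j) /\ v i = v' j) /\
      (forall j : Y, exists i : X, same (e i) (e' j) /\ v i = v' j)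
  end.

(* Hereditarily, the members of the domain are listed without repetition: the
   presented set is then a function, and the index type X is in bijection
   with its domain.  Every function on a set of names has such a presentation,
   indexed by its domain. *)
Fixpoint functional {H : Type} (x : name H) : Prop :=
  match x with
  | Name X e _ =>
      (forall i j : X, same (e i) (e j) -> i = j) /\
      (forall i : X, functional (e i))
  end.

Definition ndom {H : Type} (x : name H) : Type :=
  match x with Name X _ _ => X end.
Definition nel {H : Type} (x : name H) : ndom x -> name H :=
  match x with Name X e _ => e end.
Definition nval {H : Type} (x : name H) : ndom x -> H :=
  match x with Name X _ v => v end.

Record V (H : Type) : Type := MkV {
  V_name :> name H;
  V_functional : functional V_name
}.

Section Universe.
Context {H : Type}.

Lemma functional_nel (x : name H) (u : ndom x) :
  functional x -> functional (nel u).
Proof. by case: x u => X e v u [_ /(_ u)]. Qed.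

Definition dom (x : V H) : Type := ndom x.
Definition app (x : V H) : dom x -> H := @nval H x.

(* The element of V^(H) that an index of the domain stands for. *)
Definition domV (x : V H) (u : dom x) : V H :=
  MkV (functional_nel u (V_functional x)).

(* [stage a x]: x belongs to V^(H)_a. *)
Inductive stage : ord -> V H -> Prop :=
  Stage (a b : ord) (x : V H) :
    ord_lt b a -> (forall u : dom x, stage b (domV u)) -> stage a x.

Fixpoint name_rank (x : name H) : ord :=
  match x with
  | Name X e _ => ord_succ (ord_sup (fun i : X => name_rank (e i)))
  end.

Definition rank (x : V H) : ord := name_rank x.

Lemma stage_le a b x : stage a x -> ord_le a b -> stage b x.
Proof.
move=> ax; case: ax => {}a c {}x ca xc ab.
exact: Stage (ord_lt_le_trans ca ab) xc.
Qed.

Lemma rankP (x : V H) :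
  stage (rank x) x /\ forall a, stage a x -> ord_le (rank x) a.
Proof.
case: x; elim=> X e IH v px.
pose x := MkV px.
have IHu (u : dom x) := IH u (V_functional (domV u)).
split.
  apply: (@Stage _ (ord_sup (fun i => name_rank (e i)))).
    by exists tt; apply: ord_le_refl.
  move=> u; have [su _] := IHu u.
  exact: stage_le su (ord_le_sup (fun i => name_rank (e i)) u).
move=> a xa; rewrite -/x in xa *.
have [b ba xb] : exists2 b, ord_lt b a & forall u : dom x, stage b (domV u).
  by case: xa => {}a b y ba yb; exists b.
have sb : ord_le (ord_sup (fun i => name_rank (e i))) b.
  by apply: ord_sup_le => u; have [_ mu] := IHu u; exact: mu (xb u).
case: a ba {xa} => [K h] /= [k bk] _.
by exists k; exact: ord_le_trans sb bk.
Qed.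

End Universe.

(** * The valuation *)

Section Valuation.
Context {d : Order.disp_t} {H : completeHeytingType d}.

(* The last occurrence of [name_eq] has its arguments exchanged, for structural
   recursion; [veqE] gives the recursion equation in its usual form. *)
Fixpoint name_eq (x y : name H) : H :=
  match x, y with
  | Name X e v, Name Y e' v' =>
      Order.meet
        (hinf (fun i : X =>
           himp (v i) (hsup (fun j : Y => Order.meet (v' j) (name_eq (e i) (e' j))))))
        (hinf (fun j : Y =>
           himp (v' j) (hsup (fun i : X => Order.meet (v i) (name_eq (e i) (e' j))))))
  end.

Definition veq (x y : V H) : H := name_eq x y.

Definition vmem (x y : V H) : H :=
  hsup (fun u : dom y => Order.meet (app u) (veq x (domV u))).

Lemma name_eqC (x y : name H) : name_eq x y = name_eq y x.
Proof.
elim: x y => X e IH v [Y e' v'] /=; rewrite meetC; congr (Order.meet _ _).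
  congr hinf; apply: funext => j; congr (himp _ (hsup _)).
  by apply: funext => i; rewrite IH.
congr hinf; apply: funext => i; congr (himp _ (hsup _)).
by apply: funext => j; rewrite IH.
Qed.

Lemma veqE (x y : V H) :
  veq x y = Order.meet
    (hinf (fun w : dom x => himp (app w) (vmem (domV w) y)))
    (hinf (fun u : dom y => himp (app u) (vmem (domV u) x))).
Proof.
case: x y => [[X e v] px] [[Y e' v'] py]; rewrite /veq /=; congr (Order.meet _ _).
congr hinf; apply: funext => j; congr (himp _ (hsup _)).
by apply: funext => i; rewrite /veq /= name_eqC.
Qed.

End Valuation.

(** * Formulas of the language of set theory *)

(* [formula n] has its free variables among 'I_n; under a quantifier the new
   variable is [ord0] and the old variable [i] becomes [lift ord0 i]. *)
Inductive formula : nat -> Type :=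
  | FMem n (i j : 'I_n) : formula n
  | FEq n (i j : 'I_n) : formula n
  | FAnd n (p q : formula n) : formula n
  | FOr n (p q : formula n) : formula n
  | FImp n (p q : formula n) : formula n
  | FAll n (p : formula n.+1) : formula n
  | FEx n (p : formula n.+1) : formula n.

Definition FBAll n (i : 'I_n) (p : formula n.+1) : formula n :=
  FAll (FImp (FMem ord0 (lift ord0 i)) p).
Definition FBEx n (i : 'I_n) (p : formula n.+1) : formula n :=
  FEx (FAnd (FMem ord0 (lift ord0 i)) p).

Inductive positive_bounded : forall n, formula n -> Prop :=
  | PB_mem n (i j : 'I_n) : positive_bounded (FMem i j)
  | PB_eq n (i j : 'I_n) : positive_bounded (FEq i j)
  | PB_and n (p q : formula n) :
      positive_bounded p -> positive_bounded q -> positive_bounded (FAnd p q)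
  | PB_or n (p q : formula n) :
      positive_bounded p -> positive_bounded q -> positive_bounded (FOr p q)
  | PB_ball n (i : 'I_n) (p : formula n.+1) :
      positive_bounded p -> positive_bounded (FBAll i p)
  | PB_bex n (i : 'I_n) (p : formula n.+1) :
      positive_bounded p -> positive_bounded (FBEx i p).

Definition extend (T : Type) n (u : T) (a : 'I_n -> T) (i : 'I_n.+1) : T :=
  if unlift ord0 i is Some j then a j else u.

Fixpoint valuation {d : Order.disp_t} {H : completeHeytingType d} {n : nat}
    (p : formula n) : ('I_n -> V H) -> H :=
  match p in formula m return ('I_m -> V H) -> H with
  | FMem _ i j => fun a => vmem (a i) (a j)
  | FEq _ i j => fun a => veq (a i) (a j)
  | FAnd _ p q => fun a => Order.meet (valuation p a) (valuation q a)
  | FOr _ p q => fun a => Order.join (valuation p a) (valuation q a)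
  | FImp _ p q => fun a => himp (valuation p a) (valuation q a)
  | FAll _ p => fun a => hinf (fun u : V H => valuation p (extend u a))
  | FEx _ p => fun a => hsup (fun u : V H => valuation p (extend u a))
  end.

(** * The relation induced by a map of complete Heyting algebras *)

Section Tilde.
Context {d d' : Order.disp_t}.
Context {H : completeHeytingType d} {H' : completeHeytingType d'}.
Variable f : H -> H'.

(* Since every u in dom(x) has smaller rank than x, the recursion is well
   founded and its only solution is this inductively defined relation. *)
Inductive tilde_stage : ord -> V H -> V H' -> Prop :=
  TildeStage (a : ord) (x : V H) (y' x' : V H') (eps : dom x -> dom x') :
    stage a x ->
    veq x' y' = \top ->
    (forall v : dom x', exists u : dom x, eps u = v) ->
    (forall u : dom x, tilde_stage (rank x) (domV u) (domV (eps u))) ->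
    (forall u : dom x, app (eps u) = f (app u)) ->
    tilde_stage a x y'.

Definition tilde (x : V H) (y' : V H') : Prop :=
  exists a : ord, tilde_stage a x y'.

End Tilde.

(* Main.v *)
(** The bounded quantifiers over [x] reduce to suprema and infima over [dom x],
    by substitutivity of the valued equality.  Since [f] preserves suprema and
    binary meets, it satisfies [f (x -> y) <= f x -> f y] and
    [f (inf F) <= inf (f \o F)], so it commutes with positive bounded formulas
    up to [<=] as soon as indices in [dom x] and [dom x'] correspond, which is
    what the surjection witnessing [tilde f x y'] provides; the passage from
    [x'] to [y'] is substitutivity again. *)
Require Import Defs.
From mathcomp Require Import all_boot all_order.
From mathcomp Require Import classical_sets.

Set Implicit Arguments.
Unset Strict Implicit.
Unset Printing Implicit Defensive.

Import Order.TTheory.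
Local Open Scope order_scope.

(** * Families of elements in a complete Heyting algebra *)

Section CompleteHeyting.
Context {d : Order.disp_t} {H : completeHeytingType d}.
Implicit Types x y z : H.

Lemma hsup_ub (I : Type) (F : I -> H) i : F i <= hsup F.
Proof. by have [+ _] := bigjoin_supremum (range F); apply; exists i. Qed.

Lemma hsup_le (I : Type) (F : I -> H) x : (forall i, F i <= x) -> hsup F <= x.
Proof.
by move=> Fx; have [_] := bigjoin_supremum (range F); apply => _ [i _ <-].
Qed.

Lemma hinf_lb (I : Type) (F : I -> H) i : hinf F <= F i.
Proof.
by have [_] := bigjoin_supremum (lbound (range F)); apply => y; apply; exists i.
Qed.

Lemma hinf_ge (I : Type) (F : I -> H) x : (forall i, x <= F i) -> x <= hinf F.
Proof.
move=> xF; have [+ _] := bigjoin_supremum (lbound (range F)); apply.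
by move=> _ [i _ <-].
Qed.

Lemma himp_mp x y z : z <= x -> z <= himp x y -> z <= y.
Proof.
by move=> zx; rewrite himpP; apply: le_trans; rewrite lexI lexx.
Qed.

(** Meeting with [x] is left adjoint to [himp x], so it distributes over suprema. *)
Lemma meet_hsup_le (I : Type) (F : I -> H) x z :
  (forall i, F i `&` x <= z) -> hsup F `&` x <= z.
Proof. by move=> Fxz; rewrite -himpP; apply: hsup_le => i; rewrite himpP. Qed.

Lemma le_himp x x' y y' : x' <= x -> y <= y' -> himp x y <= himp x' y'.
Proof.
move=> x'x yy'; rewrite himpP; apply: le_trans yy'; apply: (himp_mp (x := x)).
  exact: le_trans (leIr _ _) x'x.
exact: leIl.
Qed.

End CompleteHeyting.

(** Induction on the underlying name with the functionality proof generalized, since each [domV u]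
    carries its own such proof. *)
Lemma V_ind_domV (T : Type) (P : V T -> Prop) :
  (forall x, (forall u : dom x, P (domV u)) -> P x) -> forall x, P x.
Proof.
move=> step [x]; elim: x => X e IH v px; apply: step => u; exact: IH.
Qed.

(** * Valued equality and its substitutivity *)

Section Equality.
Context {d : Order.disp_t} {H : completeHeytingType d}.
Implicit Types x y z w : V H.

Lemma veqC x y : veq x y = veq y x.
Proof. exact: name_eqC. Qed.

Lemma vmem_ub z x (u : dom x) : app u `&` veq z (domV u) <= vmem z x.
Proof. exact: (hsup_ub (fun u : dom x => app u `&` veq z (domV u))). Qed.

Lemma veq_vmem x y (u : dom x) : app u `&` veq x y <= vmem (domV u) y.
Proof.
apply: (himp_mp (x := app u)); first exact: leIl.
rewrite veqE meetCA; apply/(le_trans (leIl _ _)).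
exact: (hinf_lb (fun w : dom x => himp (app w) (vmem (domV w) y))).
Qed.

Lemma veq_ge x y (h : H) :
  (forall u : dom x, app u `&` h <= vmem (domV u) y) ->
  (forall u : dom y, app u `&` h <= vmem (domV u) x) -> h <= veq x y.
Proof.
move=> hx hy; rewrite veqE lexI; apply/andP; split;
  by apply: hinf_ge => u; rewrite himpP meetC.
Qed.

Lemma veq_refl x : veq x x = \top.
Proof.
elim/V_ind_domV: x => x IH; apply/le_anti; rewrite lex1 /=.
have top_in (u : dom x) : app u `&` \top <= vmem (domV u) x.
  by apply: le_trans (vmem_ub _ u); rewrite IH.
exact: veq_ge.
Qed.

Lemma app_le_vmem x (u : dom x) : app u <= vmem (domV u) x.
Proof. by apply: le_trans (vmem_ub _ u); rewrite veq_refl meetx1. Qed.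

(** Transitivity is assumed only at members of [x] and [y], so that both halves of the induction in
    [veq_trans] can use this. *)
Lemma vmem_veqr_of_trans z x y :
  (forall (u : dom x) (t : dom y),
    veq z (domV u) `&` veq (domV u) (domV t) <= veq z (domV t)) ->
  vmem z x `&` veq x y <= vmem z y.
Proof.
move=> tr; apply: meet_hsup_le => u; rewrite meetAC.
apply: (le_trans (leI2 (veq_vmem _ _) (lexx _))).
apply: meet_hsup_le => t; rewrite -meetA [X in _ `&` X]meetC.
exact: le_trans (leI2 (lexx _) (tr u t)) (vmem_ub _ _).
Qed.

Lemma veq_trans x y z : veq x y `&` veq y z <= veq x z.
Proof.
elim/V_ind_domV: x y z => x IH y z; apply: veq_ge => u.
  rewrite meetA; apply: (le_trans (leI2 (veq_vmem _ _) (lexx _))).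
  by apply: vmem_veqr_of_trans => ? ?; apply: IH.
(* For a member of [z], the chain is read backwards from [z] to [x]; symmetry then brings the member
   of [x] to the front, where the induction hypothesis applies. *)
rewrite (veqC x y) (veqC y z) [X in _ `&` X]meetC meetA.
apply: (le_trans (leI2 (veq_vmem _ _) (lexx _))).
apply: vmem_veqr_of_trans => v t.
by rewrite meetC (veqC (domV v)) (veqC (domV u) (domV v)) (veqC (domV u)) IH.
Qed.

Lemma vmem_veqr z x y : vmem z x `&` veq x y <= vmem z y.
Proof. by apply: vmem_veqr_of_trans => *; apply: veq_trans. Qed.

Lemma vmem_veql z w x : vmem z x `&` veq z w <= vmem w x.
Proof.
apply: meet_hsup_le => u; apply: le_trans (vmem_ub _ u).
by rewrite -meetA leI2 // meetC veqC veq_trans.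
Qed.

Lemma vmem_congr z x y : veq x y = \top -> vmem z x = vmem z y.
Proof.
move=> xy; apply/le_anti/andP; split.
  by have := vmem_veqr z x y; rewrite xy meetx1.
by have := vmem_veqr z y x; rewrite veqC xy meetx1.
Qed.

(** A single lower bound [h] for all the equalities survives quantifiers, as the new variable equals
    itself with value [\top]. The hypothesis is symmetric in [a] and [b], which handles the
    contravariant side of implication. *)
Lemma le_valuation n (p : formula n) (a b : 'I_n -> V H) (h : H) :
  (forall i, h <= veq (a i) (b i)) -> valuation p a `&` h <= valuation p b.
Proof.
elim: p a b h => {n} [n i j|n i j|n p IHp q IHq|n p IHp q IHq|n p IHp q IHq
  |n p IHp|n p IHp] a b h hab /=.
- apply: (le_trans (leI2 (lexx _) (_ : h <= veq (a i) (b i) `&` veq (a j) (b j)))).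
    by rewrite lexI !hab.
  rewrite meetA; apply: (le_trans (leI2 (vmem_veql _ _ _) (lexx _))).
  exact: vmem_veqr.
- apply: (le_trans (leI2 (lexx _) (_ : h <= veq (b i) (a i) `&` veq (a j) (b j)))).
    by rewrite lexI veqC !hab.
  rewrite meetCA meetA.
  apply: le_trans (veq_trans _ (a j) _).
  rewrite -meetA lexI; apply/andP; split; last by rewrite meetA leIr.
  by rewrite meetA; apply: (le_trans (leIl _ _)); rewrite veq_trans.
- by rewrite lexI (le_trans _ (IHp a b h hab)) ?(le_trans _ (IHq a b h hab))
    ?leI2 ?leIl ?leIr.
- by rewrite -himpP leUx !himpP (le_trans (IHp a b h hab)) ?leUl
    ?(le_trans (IHq a b h hab)) ?leUr.
- have hba i : h <= veq (b i) (a i) by rewrite veqC.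
  rewrite himpP; apply: le_trans (IHq a b h hab); rewrite lexI.
  apply/andP; split; last by rewrite meetAC leIr.
  apply: (himp_mp (x := valuation p a)); last by rewrite -meetA leIl.
  by apply: le_trans (IHp b a h hba); rewrite -meetA [X in _ <= X]meetC leIr.
- apply: hinf_ge => u; apply: le_trans (IHp (extend u a) _ h _).
    rewrite leI2 //.
    exact: (hinf_lb (fun u : V H => valuation p (extend u a))).
  by move=> i; rewrite /extend; case: unlift => //; rewrite veq_refl lex1.
- apply: meet_hsup_le => u.
  apply: le_trans (hsup_ub (fun u : V H => valuation p (extend u b)) u).
  apply: IHp => i; rewrite /extend; case: unlift => //.
  by rewrite veq_refl lex1.
Qed.

Lemma le_valuation_extend n (p : formula n.+1) (a : 'I_n -> V H) u w :
  valuation p (extend u a) `&` veq u w <= valuation p (extend w a).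
Proof.
apply: le_valuation => i; rewrite /extend; case: unlift => // j.
by rewrite veq_refl lex1.
Qed.

(** * Bounded quantifiers as bounds over a domain *)

Lemma extend_ord0 (u : V H) n (a : 'I_n -> V H) : extend u a ord0 = u.
Proof. by rewrite /extend unlift_none. Qed.

Lemma extend_lift (u : V H) n (a : 'I_n -> V H) i :
  extend u a (lift ord0 i) = a i.
Proof. by rewrite /extend liftK. Qed.

(** The domain may be that of any [x] equal to [a i] with value [\top]: this covers both [a i]
    itself and the intermediate name supplied by [tilde]. *)
Lemma valuation_FBEx n (i : 'I_n) (p : formula n.+1) a x :
  veq x (a i) = \top ->
  valuation (FBEx i p) a =
  hsup (fun u : dom x => app u `&` valuation p (extend (domV u) a)).
Proof.
move=> xa; apply/le_anti/andP; split; apply: hsup_le => u.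
  rewrite /= extend_ord0 extend_lift -(vmem_congr _ xa).
  apply: meet_hsup_le => v.
  apply: (le_trans _ (hsup_ub _ v)).
  by rewrite -meetA leI2 // meetC le_valuation_extend.
apply: (le_trans _ (hsup_ub _ (domV u))).
by rewrite /= extend_ord0 extend_lift -(vmem_congr _ xa) leI2 // app_le_vmem.
Qed.

Lemma valuation_FBAll n (i : 'I_n) (p : formula n.+1) a x :
  veq x (a i) = \top ->
  valuation (FBAll i p) a =
  hinf (fun u : dom x => himp (app u) (valuation p (extend (domV u) a))).
Proof.
move=> xa; apply/le_anti/andP; split; apply: hinf_ge => u.
  apply: (le_trans (hinf_lb _ (domV u))).
  by rewrite /= extend_ord0 extend_lift -(vmem_congr _ xa) le_himp // app_le_vmem.
rewrite /= extend_ord0 extend_lift -(vmem_congr _ xa) himpP meetC.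
apply: meet_hsup_le => v.
(* An arbitrary [u] lies in [x] to the extent that it equals some [domV v]: instantiate the infimum
   at [v], then substitute [u]. *)
apply: le_trans (le_valuation_extend p a (domV v) u).
rewrite lexI [X in _ && (_ <= X)]veqC [X in _ && (X <= _)]meetAC leIr andbT.
apply: (himp_mp (x := app v)); first by rewrite -meetA leIl.
apply: (le_trans (leIr _ _)); exact: (hinf_lb _ v).
Qed.

End Equality.

(** * Transfer along [f] and [tilde f] *)

Section Morphism.
Context {d d' : Order.disp_t}.
Context {H : completeHeytingType d} {H' : completeHeytingType d'}.
Variable f : H -> H'.
Hypotheses (f_sup : preserves_suprema f) (f_inf : preserves_finite_infima f).

Lemma morph_meet x y : f (x `&` y) = f x `&` f y.
Proof. by case: f_inf. Qed.

Lemma morph_le x y : x <= y -> f x <= f y.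
Proof. by move=> /meet_idPl <-; rewrite morph_meet leIr. Qed.

Lemma morph_hsup (I : Type) (F : I -> H) : f (hsup F) = hsup (f \o F).
Proof. by rewrite /hsup f_sup image_comp. Qed.

(** A binary join is a supremum indexed by [bool]. *)
Lemma morph_join x y : f (x `|` y) <= f x `|` f y.
Proof.
pose F b := if b then x else y.
apply: (@le_trans _ _ (f (hsup F))).
  by apply: morph_le; rewrite leUx (hsup_ub F true) (hsup_ub F false).
by rewrite morph_hsup; apply: hsup_le => -[]; rewrite ?leUl ?leUr.
Qed.

(** By adjunction, it is enough to apply [f] to modus ponens in [H]. *)
Lemma morph_himp x y : f (himp x y) <= himp (f x) (f y).
Proof.
rewrite himpP -morph_meet; apply: morph_le.
by apply: (himp_mp (x := x)); rewrite ?leIl ?leIr.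
Qed.

Lemma morph_hinf_himp (I : Type) (F G : I -> H) (h : H) i :
  h <= hinf (fun i => himp (F i) (G i)) -> f h <= himp (f (F i)) (f (G i)).
Proof.
move=> hF; apply: le_trans (morph_himp _ _); apply: morph_le.
exact: le_trans hF (hinf_lb _ i).
Qed.

Lemma tildeP x y' : tilde f x y' ->
  exists (x' : V H') (eps : dom x -> dom x'),
    [/\ veq x' y' = \top,
        forall v, exists u, eps u = v,
        forall u, tilde f (domV u) (domV (eps u)) &
        forall u, app (eps u) = f (app u)].
Proof.
case=> a []; move=> {}a {}x {}y' x' eps _ xy' surj til val.
by exists x', eps; split=> // u; exists (rank x).
Qed.

(** The bound on equalities is a hypothesis at members of [y], so that this serves inside the
    induction of [tilde_veq] as well as after it. *)
Lemma tilde_vmem_dom x y x' z' (eps : dom y -> dom z') :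
  (forall u, app (eps u) = f (app u)) ->
  (forall u, f (veq x (domV u)) <= veq x' (domV (eps u))) ->
  f (vmem x y) <= vmem x' z'.
Proof.
move=> val le_eq; rewrite morph_hsup; apply: hsup_le => u /=.
by apply: le_trans (vmem_ub _ (eps u)); rewrite morph_meet val leI2.
Qed.

Lemma tilde_veq x x' y y' :
  tilde f x x' -> tilde f y y' -> f (veq x y) <= veq x' y'.
Proof.
elim/V_ind_domV: x x' y y' => x IH x' y y'.
move=> /tildeP[x1 [ex [xx' sx tx vx]]] /tildeP[y1 [ey [yy' sy ty vy]]].
(* Since [x1] and [y1] equal [x'] and [y'] with value [\top], the claim reduces to names whose
   domains are the images of [ex] and [ey]. *)
suff le1 : f (veq x y) <= veq x1 y1.
  apply: (le_trans le1); apply: le_trans (veq_trans _ y1 _).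
  rewrite yy' meetx1; apply: le_trans (veq_trans _ x1 _).
  by rewrite (veqC x') xx' meet1x.
apply: veq_ge => v.
  have [u <-] := sx v; rewrite vx -morph_meet.
  apply: (le_trans (morph_le (veq_vmem y u))).
  apply: tilde_vmem_dom vy _ => t; exact: IH.
have [u <-] := sy v; rewrite vy -morph_meet veqC.
apply: (le_trans (morph_le (veq_vmem x u))).
apply: tilde_vmem_dom vx _ => t.
(* Both equalities are flipped to put the member of [x], on which the induction runs, first. *)
by rewrite veqC (veqC _ (domV (ex t))); exact: IH.
Qed.

Lemma tilde_vmem x x' y y' :
  tilde f x x' -> tilde f y y' -> f (vmem x y) <= vmem x' y'.
Proof.
move=> xx' /tildeP[y1 [ey [yy' _ ty vy]]].
rewrite -(vmem_congr _ yy'); apply: tilde_vmem_dom vy _ => u.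
exact: tilde_veq.
Qed.

Lemma tilde_extend n (a : 'I_n -> V H) (a' : 'I_n -> V H') u u' :
  (forall i, tilde f (a i) (a' i)) -> tilde f u u' ->
  forall i, tilde f (extend u a i) (extend u' a' i).
Proof. by move=> aa' uu' i; rewrite /extend; case: unlift. Qed.

End Morphism.

Theorem corollary3p9 (d d' : Order.disp_t)
    (H : completeHeytingType d) (H' : completeHeytingType d') (f : H -> H')
    (f_sup : preserves_suprema f) (f_inf : preserves_finite_infima f)
    (n : nat) (phi : formula n) (phi_pb : positive_bounded phi)
    (a : 'I_n -> V H) (a' : 'I_n -> V H')
    (aa' : forall i : 'I_n, tilde f (a i) (a' i)) :
  (f (valuation phi a) <= valuation phi a')%O.
Proof.
elim: phi_pb a a' aa' => {n phi} [n i j|n i j|n p q _ IHp _ IHq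
  |n p q _ IHp _ IHq|n i p _ IHp|n i p _ IHp] a a' aa'.
- exact: tilde_vmem.
- exact: tilde_veq.
- by rewrite /= morph_meet // leI2 ?IHp ?IHq.
- by rewrite /= (le_trans (morph_join f_sup f_inf _ _)) // leU2 ?IHp ?IHq.
- have [x' [eps [xa surj til val]]] := tildeP (aa' i).
  rewrite (valuation_FBAll p (veq_refl (a i))) (valuation_FBAll p xa).
  (* Surjectivity gives every conjunct over [dom x'] a source conjunct over [dom (a i)]. *)
  apply: hinf_ge => v; have [u <-] := surj v.
  apply: (le_trans (morph_hinf_himp f_inf u (lexx _))).
  by rewrite val le_himp // IHp //; apply: tilde_extend.
- have [x' [eps [xa _ til val]]] := tildeP (aa' i).
  rewrite (valuation_FBEx p (veq_refl (a i))) (valuation_FBEx p xa).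
  rewrite morph_hsup //; apply: hsup_le => u /=.
  (* The disjunct at [u] is carried forward to the one at [eps u]. *)
  apply: (le_trans _ (hsup_ub _ (eps u))).
  by rewrite morph_meet // val leI2 // IHp //; apply: tilde_extend.
Qed.
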